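(* Let $E,F$ be Banach spaces, let $(\pi_n)_{n\in\mathbb N}$ be a sequence of partitions of $\mathbb R_{\ge 0}$ and let $(X,Y)\in D(\mathbb R_{\ge 0},E\times F)$. Then the following conditions are equivalent: (i) $(X,Y)$ has strong (resp. weak) projective tensor quadratic covariation $[X,Y]$ along $(\pi_n)$. (ii) For every Banach space $G$ and every bounded bilinear map $B\in\mathcal L^{(2)}(E,F;G)$, $(X,Y)$ has strong (resp. weak) $B$-quadratic covariation along $(\pi_n)$. If these conditions are satisfied, then $T_B\circ [X,Y]=Q_B(X,Y)$ for every Banach space $G$ and every $B\in \mathcal L^{(2)}(E,F;G)$, where $T_B\colon E\widehat\otimes F\to G$ is the unique bounded linear map with $T_B\circ\otimes=B$.
   Context: All Banach spaces are real. $\mathcal L^{(2)}(E,F;G)$ is the space of bounded bilinear maps $E\times F\to G$. A partition of $\mathbb R_{\ge0}$ is a set $\pi=\{\,]t_i,t_{i+1}] : i\in\mathbb N\}$ with $0=t_0<t_1<\dots\to\infty$. $D(\mathbb R_{\ge0},E)$ is the set of càdlàg (right-continuous with left limits) paths $\mathbb R_{\ge0}\to E$; $\Delta X_t=X_t-X_{t-}$ for $t>0$ and $\Delta X_0=0$. For $I=]r,s]$ put $\delta X_t(I)=X_{s\wedge t}-X_{r\wedge t}$. A path has finite variation if its total variation on each compact interval is finite. Given $B\in\mathcal L^{(2)}(E,F;G)$, $(X,Y)\in D(\mathbb R_{\ge0},E\times F)$ has strong (resp. weak) $B$-quadratic covariation along $(\pi_n)$ if there is a $G$-valued càdlàg path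 $Q_B(X,Y)$ of finite variation such that (1) for every $t\ge0$, $\sum_{I\in\pi_n}B(\delta X_t(I),\delta Y_t(I))\to Q_B(X,Y)_t$ in the norm (resp. weak) topology of $G$ as $n\to\infty$; (2) $\Delta Q_B(X,Y)_t=B(\Delta X_t,\Delta Y_t)$ for all $t\ge0$. $E\widehat\otimes F$ is the completed projective tensor product; the strong (weak) projective tensor quadratic covariation $[X,Y]$ is the strong (weak) $B$-quadratic covariation for the canonical bilinear map $B=\otimes\colon E\times F\to E\widehat\otimes F$. *)

(* Defs.v *)
From HB Require Import structures.
From mathcomp Require Import all_boot all_order all_algebra.
From mathcomp Require Import all_classical all_reals all_analysis.
From mathcomp Require Import freeg.

Set Implicit Arguments.
Unset Strict Implicit.
Unset Printing Implicit Defensive.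
Import Order.TTheory GRing.Theory Num.Theory numFieldNormedType.Exports.
Local Open Scope classical_set_scope.
Local Open Scope ring_scope.
Local Open Scope quotient_scope.

Record submodule (R : pzRingType) (V : lmodType R) := Submodule {
  submodule_pred :> {pred V};
  submoduleP : submod_closed submodule_pred }.

HB.instance Definition _ (R : pzRingType) (V : lmodType R) (S : submodule V) :=
  GRing.isSubmodClosed.Build R V (submodule_pred S) (submoduleP S).

(* MathComp's [Quotient.quot] provides the Z-module structure only. *)
Definition lquot (R : pzRingType) (V : lmodType R) (S : submodule V) : Type :=
  Quotient.quot (GRing.ZmodClosed.clone V (submodule_pred S) _).

Section lquot.
Variables (R : pzRingType) (V : lmodType R) (S : submodule V).

HB.instance Definition _ := GRing.Zmodule.on (lquot S).
HB.instance Definition _ := ZmodQuotient.on (lquot S).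

Definition lpi (v : V) : lquot S := \pi_(lquot S) v.

Lemma lpi_eq (u v : V) : lpi u = lpi v <-> u - v \in S.
Proof.
rewrite Quotient.idealrBE; split=> [e|/eqP e]; last exact: e.
by apply/eqP; exact: e.
Qed.

Lemma lpiD : {morph lpi : u v / u + v}.
Proof. by move=> u v; rewrite /lpi raddfD. Qed.

Lemma lpi_surj (x : lquot S) : exists v, x = lpi v.
Proof. by exists (repr x); rewrite /lpi reprK. Qed.

Definition lquot_scale (a : R) (x : lquot S) : lquot S := lpi (a *: repr x).

Lemma lpiZ a (v : V) : lquot_scale a (lpi v) = lpi (a *: v).
Proof.
apply/lpi_eq; rewrite -scalerBr rpredZ//.
by apply/lpi_eq; rewrite /lpi reprK.
Qed.

Fact lquot_scaleA a b x :
  lquot_scale a (lquot_scale b x) = lquot_scale (a * b) x.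
Proof. by have [v ->] := lpi_surj x; rewrite !lpiZ scalerA. Qed.

Fact lquot_scale1 : left_id 1 lquot_scale.
Proof. by move=> x; have [v ->] := lpi_surj x; rewrite lpiZ scale1r. Qed.

Fact lquot_scaleDr : right_distributive lquot_scale +%R.
Proof.
move=> a x y; have [u ->] := lpi_surj x; have [v ->] := lpi_surj y.
by rewrite -lpiD !lpiZ -lpiD scalerDr.
Qed.

Fact lquot_scaleDl x : {morph lquot_scale^~ x : a b / a + b}.
Proof.
by move=> a b; have [v ->] := lpi_surj x; rewrite !lpiZ -lpiD scalerDl.
Qed.

HB.instance Definition _ := GRing.Zmodule_isLmodule.Build R (lquot S)
  lquot_scaleA lquot_scale1 lquot_scaleDr lquot_scaleDl.

Fact lpi_is_linear : linear lpi.
Proof. by move=> a u v; rewrite lpiD -lpiZ. Qed.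

HB.instance Definition _ :=
  GRing.isLinear.Build R V (lquot S) *:%R lpi lpi_is_linear.

End lquot.

Section lspan.
Variables (R : pzRingType) (V : lmodType R) (A : set V).

Inductive in_lspan : V -> Prop :=
| in_lspan0 : in_lspan 0
| in_lspanS a u v : A u -> in_lspan v -> in_lspan (a *: u + v).

Definition lspan_pred : pred V := fun v => `[< in_lspan v >].

Lemma in_lspanD u v : in_lspan u -> in_lspan v -> in_lspan (u + v).
Proof.
move=> + vA; elim=> [|a u1 u2 Au1 _ IH]; first by rewrite add0r.
by rewrite -addrA; exact: in_lspanS.
Qed.

Lemma in_lspanZ a u : in_lspan u -> in_lspan (a *: u).
Proof.
elim=> [|b u1 u2 Au1 _ IH]; first by rewrite scaler0; exact: in_lspan0.
by rewrite scalerDr scalerA; exact: in_lspanS.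
Qed.

Fact lspan_submod_closed : submod_closed lspan_pred.
Proof.
split; first exact/asboolP/in_lspan0.
move=> a u v /asboolP Au /asboolP Av; apply/asboolP.
by apply: in_lspanD => //; exact: in_lspanZ.
Qed.

Definition lspan : submodule V := Submodule lspan_submod_closed.

End lspan.

Record seminorm (R : realType) (V : lmodType R) := Seminorm {
  seminorm_fun :> V -> R;
  seminormD : forall u v, seminorm_fun (u + v) <= seminorm_fun u + seminorm_fun v;
  seminormZ : forall (a : R) u, seminorm_fun (a *: u) = `|a| * seminorm_fun u }.

Section seminorm_theory.
Variables (R : realType) (V : lmodType R) (p : seminorm V).

Lemma seminorm0 : p 0 = 0.
Proof. by rewrite -(scale0r 0) seminormZ normr0 mul0r. Qed.

Lemma seminormN u : p (- u) = p u.
Proof. by rewrite -scaleN1r seminormZ normrN1 mul1r. Qed.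

Lemma seminormB u v : p (u - v) = p (v - u).
Proof. by rewrite -opprB seminormN. Qed.

Lemma seminorm_ge0 u : 0 <= p u.
Proof.
have := seminormD p u (- u); rewrite subrr seminorm0 seminormN -mulr2n.
by rewrite pmulrn_lge0.
Qed.

Lemma seminorm_dist u v : `|p u - p v| <= p (u - v).
Proof.
have le x y : p x - p y <= p (x - y).
  by rewrite lerBlDr (le_trans _ (seminormD p _ _))// subrK.
by rewrite ler_norml le andbT lerNl opprB seminormB le.
Qed.

Lemma seminorm_tri w u v : p (u - v) <= p (u - w) + p (w - v).
Proof. by rewrite (le_trans _ (seminormD p _ _))// addrA subrK. Qed.

Definition cauchy_seq : pred (nat -> V) := fun u =>
  `[< forall e : R, 0 < e -> exists N : nat, forall m n : nat,
      (N <= m)%N -> (N <= n)%N -> p (u m - u n) < e >].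

Fact cauchy_seq_submod_closed : submod_closed cauchy_seq.
Proof.
split=> [|a u v /asboolP uC /asboolP vC]; apply/asboolP => e e0.
  by exists 0%N => m n _ _; rewrite /= subrr seminorm0.
have a0 : 0 < `|a| + 1 by rewrite ltr_wpDl.
have [N uN] := uC (e / 2 / (`|a| + 1)) (divr_gt0 (divr_gt0 e0 (ltr0Sn _ _)) a0).
have [M vM] := vC (e / 2) (divr_gt0 e0 (ltr0Sn _ _)).
exists (maxn N M) => m n; rewrite !geq_max => /andP[Nm Mm] /andP[Nn Mn].
rewrite [e]splitr; have -> : (a *: u + v) m - (a *: u + v) n =
    a *: (u m - u n) + (v m - v n).
  by rewrite scalerBr /= addrACA opprD.
rewrite (le_lt_trans (seminormD p _ _))// ltr_leD ?vM ?ltW ?vM//.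
rewrite seminormZ (@le_lt_trans _ _ ((`|a| + 1) * p (u m - u n)))//.
  by rewrite ler_wpM2r ?seminorm_ge0// lerDl.
by rewrite mulrC -ltr_pdivlMr// uN.
Qed.

HB.instance Definition _ := GRing.isSubmodClosed.Build R (nat -> V) cauchy_seq
  cauchy_seq_submod_closed.

Record cauchyT := CauchyT { cauchyT_val : nat -> V;
                            cauchyTP : cauchyT_val \in cauchy_seq }.

HB.instance Definition _ := [isSub for cauchyT_val].
HB.instance Definition _ := [Choice of cauchyT by <:].
HB.instance Definition _ := [SubChoice_isSubLmodule of cauchyT by <:].


Lemma cauchyTE (u : cauchyT) (e : R) : 0 < e -> exists N : nat,
  forall m n : nat, (N <= m)%N -> (N <= n)%N ->
    p (cauchyT_val u m - cauchyT_val u n) < e.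
Proof. by move: e; exact/asboolP/(cauchyTP u). Qed.

Lemma cauchyT_cvg (u : cauchyT) : cvg (p (cauchyT_val u n) @[n --> \oo]).
Proof.
apply/cauchy_cvgP/cauchy_exP => e e0; have [N uN] := cauchyTE u e0.
exists (p (cauchyT_val u N)); exists N => // n /= Nn.
by rewrite /ball/= (le_lt_trans (seminorm_dist _ _))// uN.
Qed.

Definition null_seq : {pred cauchyT} := fun u =>
  `[< p (cauchyT_val u n) @[n --> \oo] --> 0 >].

Fact null_seq_submod_closed : submod_closed null_seq.
Proof.
split=> [|a u v /asboolP u0 /asboolP v0]; apply/asboolP.
  by under eq_fun do rewrite /= seminorm0; exact: cvg_cst.
have bnd0 : `|a| * p (cauchyT_val u n) + p (cauchyT_val v n) @[n --> \oo] --> 0.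
  rewrite -[X in _ --> X]addr0 -[X in _ --> X + _](mulr0 `|a|).
  by apply: cvgD => //; apply: cvgMr.
apply: squeeze_cvgr (cvg_cst 0) bnd0; apply: nearW => n.
by rewrite seminorm_ge0/= (le_trans (seminormD _ _ _))// seminormZ.
Qed.

Definition null_submodule := Submodule null_seq_submod_closed.

Definition completion : Type := lquot null_submodule.

HB.instance Definition _ := GRing.Lmodule.on completion.

Definition completion_norm (z : completion) : R :=
  lim (p (cauchyT_val (repr z) n) @[n --> \oo]).


Lemma completion_norm_cvg (u : cauchyT) :
  p (cauchyT_val u n) @[n --> \oo] --> completion_norm (lpi null_submodule u).
Proof.
set z := lpi _ u; have /asboolP e : u - repr z \in (null_submodule : {pred _}).
  by apply/lpi_eq; rewrite /z /lpi reprK.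
apply: (@cvg_sub0 _ _ _ _ _ _ (fun n => p (cauchyT_val (repr z) n)));
  last exact: cauchyT_cvg.
apply/cvgr0Pnorm_lt => d d0; move/cvgr0Pnorm_lt/(_ d d0) : e.
apply: filterS => n; apply: le_lt_trans.
by rewrite (le_trans (seminorm_dist _ _))// ler_norm.
Qed.

Lemma completion_normE (u : cauchyT) : completion_norm (lpi null_submodule u) =
  lim (p (cauchyT_val u n) @[n --> \oo]).
Proof. by apply/esym/cvg_lim => //; exact: completion_norm_cvg. Qed.

Fact completion_normD x y :
  completion_norm (x + y) <= completion_norm x + completion_norm y.
Proof.
have [u ->] := lpi_surj x; have [v ->] := lpi_surj y; rewrite -lpiD.
apply: (ler_cvg_to (@completion_norm_cvg (u + v))
  (cvgD (@completion_norm_cvg u) (@completion_norm_cvg v))).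
by apply: nearW => n; rewrite /= seminormD.
Qed.

Fact completion_normZ (a : R) x :
  completion_norm (a *: x) = `|a| * completion_norm x.
Proof.
have [u ->] := lpi_surj x; rewrite -linearZ [LHS]completion_normE.
apply/cvg_lim => //; under eq_fun do rewrite /= seminormZ.
exact: cvgMl_tmp (@completion_norm_cvg u).
Qed.

Fact completion_norm_eq0 x : completion_norm x = 0 -> x = 0.
Proof.
have [u ->] := lpi_surj x => u0; rewrite -(linear0 (lpi null_submodule)).
apply/lpi_eq; rewrite subr0; apply/asboolP; rewrite -u0.
exact: completion_norm_cvg.
Qed.

HB.instance Definition _ := Lmodule_isNormed.Build R completion
  completion_normD completion_normZ completion_norm_eq0.

Fact cst_cauchy (v : V) : (fun _ => v) \in cauchy_seq.
Proof.
by apply/asboolP => e e0; exists 0%N => m n _ _; rewrite subrr seminorm0.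
Qed.

Definition completion_in (v : V) : completion :=
  lpi null_submodule (CauchyT (cst_cauchy v)).

Fact completion_in_linear : linear completion_in.
Proof.
move=> a u v; rewrite -[RHS](linearP (lpi null_submodule)).
by congr (lpi _ _); apply/val_inj/funext => n.
Qed.

HB.instance Definition _ := GRing.isLinear.Build R V completion *:%R
  completion_in completion_in_linear.

Lemma completion_in_norm v : `|completion_in v| = p v.
Proof.
by rewrite [LHS]completion_normE /= lim_cst.
Qed.

Lemma completion_in_cvg (u : cauchyT) :
  completion_in (cauchyT_val u n) @[n --> \oo] --> (lpi null_submodule u : completion).
Proof.
apply/cvgrPdist_le => e e0; have [N uN] := cauchyTE u e0.
exists N => // n /= Nn; rewrite /completion_in -linearB.
apply: (cvgr_to_le (@completion_norm_cvg _)).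
by exists N => // m /= Nm; rewrite ltW// uN.
Qed.

Lemma completion_in_dense : dense (range completion_in).
Proof.
move=> O [x Ox] /(_ _ Ox); have [u xE] := lpi_surj x.
rewrite xE => /completion_in_cvg[N _ /(_ N (leqnn N)) ON].
by exists (completion_in (cauchyT_val u N)); split => //; exists (cauchyT_val u N).
Qed.

Fact completion_complete (F : set_system completion) :
  ProperFilter F -> cauchy F -> cvg F.
Proof.
move=> FF /cauchyP Fc.
have /choice[v vF] : forall n : nat, exists v : V,
    F (ball (completion_in v) n.+1%:R^-1).
  move=> n; have n0 : 0 < n.+1%:R^-1 / 2 :> R by [].
  have [x Fx] := Fc _ n0.
  have [u xE] := lpi_surj x.
  have /cvgrPdist_lt/(_ _ n0)[N _ /(_ N (leqnn N)) xN] := @completion_in_cvg u.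
  exists (cauchyT_val u N); apply: filterS Fx => y xy.
  apply: (@ball_splitr _ _ x); last exact: xy.
  by rewrite -ball_normE /= xE.
have vd m n : p (v m - v n) < m.+1%:R^-1 + n.+1%:R^-1.
  have [y [ym yn]] := filter_ex (filterI (vF m) (vF n)).
  rewrite -completion_in_norm linearB -(subrKA y) (le_lt_trans (ler_normD _ _))//.
  move: ym yn; rewrite -!ball_normE/= => ym yn.
  by rewrite ltrD// distrC.
have vC : v \in cauchy_seq.
  apply/asboolP => e e0; have e20 : 0 < e / 2 by rewrite divr_gt0.
  have [N _ Ne] := near_infty_natSinv_lt (PosNum e20).
  exists N => m n Nm Nn; rewrite (lt_trans (vd m n))// [e]splitr.
  by rewrite ltrD//; exact: Ne.
pose z : completion := lpi null_submodule (CauchyT vC).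
apply/cvg_ex; exists z; apply/cvg_ballP => e e0.
have e20 : 0 < e / 2 by rewrite divr_gt0.
have [N _ Ne] := near_infty_natSinv_lt (PosNum e20).
have /cvgrPdist_lt/(_ _ e20)[M _ Me] := @completion_in_cvg (CauchyT vC).
apply: filterS (vF (maxn N M)) => y vy.
apply: (@ball_split _ _ (completion_in (v (maxn N M)))).
  by rewrite -ball_normE /=; exact: Me (leq_maxr _ _).
by apply: le_ball vy; rewrite ltW//; exact: Ne (leq_maxl _ _).
Qed.

HB.instance Definition _ := Uniform_isComplete.Build completion completion_complete.

End seminorm_theory.

Section algebraic_tensor.
Variables (R : realType) (E F : lmodType R).

Variant bilinear_relation : {freeg (E * F) / R} -> Prop :=
| bilinear_relationDl x x' y :
    bilinear_relation (<<(x + x', y)>> - (<<(x, y)>> + <<(x', y)>>))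
| bilinear_relationDr x y y' :
    bilinear_relation (<<(x, y + y')>> - (<<(x, y)>> + <<(x, y')>>))
| bilinear_relationZl a x y :
    bilinear_relation (<<(a *: x, y)>> - a *: <<(x, y)>>)
| bilinear_relationZr a x y :
    bilinear_relation (<<(x, a *: y)>> - a *: <<(x, y)>>).

Definition atensor : Type := lquot (lspan bilinear_relation).

HB.instance Definition _ := GRing.Lmodule.on atensor.

Definition atens (x : E) (y : F) : atensor :=
  lpi (lspan bilinear_relation) <<(x, y)>>.

Lemma bilinear_relation_pi f g :
  bilinear_relation (f - g) ->
  lpi (lspan bilinear_relation) f = lpi (lspan bilinear_relation) g.
Proof.
move=> fg; apply/lpi_eq/asboolP.
by rewrite -[f - g]scale1r -[_ *: _]addr0; exact/in_lspanS/in_lspan0.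
Qed.

Lemma atensDl y : {morph atens^~ y : x x' / x + x'}.
Proof.
move=> x x'; rewrite /atens -lpiD.
exact/bilinear_relation_pi/bilinear_relationDl.
Qed.

Lemma atensDr x : {morph atens x : y y' / y + y'}.
Proof.
move=> y y'; rewrite /atens -lpiD.
exact/bilinear_relation_pi/bilinear_relationDr.
Qed.

Lemma atensZl a x y : atens (a *: x) y = a *: atens x y.
Proof.
rewrite /atens -linearZ.
exact/bilinear_relation_pi/bilinear_relationZl.
Qed.

Lemma atensZr a x y : atens x (a *: y) = a *: atens x y.
Proof.
rewrite /atens -linearZ.
exact/bilinear_relation_pi/bilinear_relationZr.
Qed.

Definition tensor_sum (s : seq (E * F)) : atensor :=
  \sum_(z <- s) atens z.1 z.2.

Lemma tensor_sum_surj (u : atensor) : exists s, u = tensor_sum s.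
Proof.
have [f ->] := lpi_surj u.
exists [seq (coeff z f *: z.1, z.2) | z <- dom f].
rewrite -{1}(freeg_sumE f) linear_sum /tensor_sum [RHS]big_map.
apply: eq_bigr => -[x y] _ /=; rewrite atensZl -linearZ; congr (lpi _ _).
by apply/eqP/freeg_eqP => z; rewrite coeffZ !coeffU mul1r.
Qed.

End algebraic_tensor.

Section projective_norm.
Variables (R : realType) (E F : normedModType R).

Definition rep_norm (s : seq (E * F)) : R := \sum_(z <- s) `|z.1| * `|z.2|.

Definition proj_norm (u : atensor E F) : R :=
  inf [set rep_norm s | s in [set s | u = tensor_sum s]].

Lemma rep_norm_ge0 s : 0 <= rep_norm s.
Proof. by apply: sumr_ge0 => z _; rewrite mulr_ge0. Qed.

Lemma proj_norm_le u s : u = tensor_sum s -> proj_norm u <= rep_norm s.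
Proof.
move=> us; apply: ge_inf; last by exists s.
by exists 0 => _ [s' _ <-]; exact: rep_norm_ge0.
Qed.

Lemma proj_norm_ge u c :
  (forall s, u = tensor_sum s -> c <= rep_norm s) -> c <= proj_norm u.
Proof.
move=> uc; apply: lb_le_inf; last by move=> _ [s us <-]; exact: uc.
by have [s us] := tensor_sum_surj u; exists (rep_norm s); exists s.
Qed.

Fact proj_normD u v : proj_norm (u + v) <= proj_norm u + proj_norm v.
Proof.
rewrite -lerBlDl; apply: proj_norm_ge => s' ->; rewrite lerBlDl -lerBlDr.
apply: proj_norm_ge => s ->; rewrite lerBlDr.
rewrite (@le_trans _ _ (rep_norm (s ++ s')))//.
  by apply: proj_norm_le; rewrite /tensor_sum big_cat.
by rewrite /rep_norm big_cat.
Qed.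

Fact proj_normZ (a : R) u : proj_norm (a *: u) = `|a| * proj_norm u.
Proof.
have le b v : proj_norm (b *: v) <= `|b| * proj_norm v.
  have [->|b0] := eqVneq b 0.
    rewrite scale0r normr0 mul0r (le_trans (@proj_norm_le _ [::] _))//.
      by rewrite /tensor_sum big_nil.
    by rewrite /rep_norm big_nil.
  rewrite -ler_pdivrMl ?normr_gt0//; apply: proj_norm_ge => s ->.
  rewrite ler_pdivrMl ?normr_gt0//.
  rewrite (le_trans (@proj_norm_le _ [seq (b *: z.1, z.2) | z <- s] _))//.
    rewrite /tensor_sum scaler_sumr big_map.
    by apply: eq_bigr => z _; rewrite atensZl.
  rewrite /rep_norm big_map mulr_sumr ler_sum// => z _.
  by rewrite normrZ mulrA.
apply/eqP; rewrite eq_le le/=; have [->|a0] := eqVneq a 0.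
  rewrite normr0 mul0r; apply: proj_norm_ge => s _; exact: rep_norm_ge0.
rewrite -ler_pdivlMl ?normr_gt0// -normfV.
by rewrite -{1}[u]scale1r -(mulVf a0) -scalerA le.
Qed.

Definition proj_seminorm := Seminorm proj_normD proj_normZ.

Definition ptensor : Type := completion proj_seminorm.

HB.instance Definition _ := CompleteNormedModule.on ptensor.

Definition ptens (x : E) (y : F) : ptensor :=
  completion_in proj_seminorm (atens x y).

Fact ptens_bilinear :
  bilinear_for (GRing.Scale.Law.clone _ _ *:%R _)
    (GRing.Scale.Law.clone _ _ *:%R _) ptens.
Proof.
split=> [y a x x'|x a y y'].
  by rewrite /ptens atensDl atensZl linearP.
by rewrite /ptens atensDr atensZr linearP.
Qed.

HB.instance Definition _ :=
  bilinear_isBilinear.Build R E F ptensor *:%R *:%R ptens ptens_bilinear.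

Lemma ptens_norm x y : `|ptens x y| <= `|x| * `|y|.
Proof.
rewrite completion_in_norm (le_trans (@proj_norm_le _ [:: (x, y)] _))//.
  by rewrite /tensor_sum big_seq1.
by rewrite /rep_norm big_seq1.
Qed.

End projective_norm.

(* Paths indexed by the nonnegative reals are functions on [R] of which only the
   restriction to nonnegative times matters. *)

Section paths.
Variable R : realType.

Definition cadlag (T : topologicalType) (X : R -> T) : Prop :=
  forall t, 0 <= t ->
    X @ t^'+ --> X t /\ (0 < t -> exists l : T, X @ t^'- --> l).

Definition jump (V : normedModType R) (X : R -> V) (t : R) : V :=
  if 0 < t then X t - lim (X @ t^'-) else 0.

(* [numfun.variation] and [realfun.total_variation] for vector-valued paths. *)
Definition path_variation (V : normedModType R) (a b : R) (X : R -> V)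
    (s : seq R) : R :=
  let Y := X \o nth b (a :: s) in \sum_(0 <= n < size s) `|Y n.+1 - Y n|.

Definition path_total_variation (V : normedModType R) (a b : R) (X : R -> V)
    : \bar R :=
  ereal_sup [set (path_variation a b X s)%:E | s in itv_partition a b].

Definition finite_variation (V : normedModType R) (X : R -> V) : Prop :=
  forall a b, 0 <= a -> a <= b -> (path_total_variation a b X < +oo)%E.

(* The partition of the nonnegative half-line into the intervals
   ]pt i, pt i.+1]. *)
Record time_partition := TimePartition {
  pt :> nat -> R;
  pt0 : pt 0%N = 0;
  pt_lt : forall i, pt i < pt i.+1;
  pt_oo : pt @ \oo --> +oo }.

Definition increment (V : zmodType) (X : R -> V) (r s t : R) : V :=
  X (Num.min s t) - X (Num.min r t).

(* Only the indices [i] with [pi i < t] contribute when [B] is bilinear, so the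
   sum has finite support. *)
Definition covariation_sum (U V W : zmodType) (B : U -> V -> W)
    (pi : time_partition) (X : R -> U) (Y : R -> V) (t : R) : W :=
  \sum_(i \in [set: nat])
    B (increment X (pi i) (pi i.+1) t) (increment Y (pi i) (pi i.+1) t).

End paths.

Section boundedness.
Variables (R : realType) (E F G : normedModType R).

Definition bounded_linear (T : {linear E -> G}) : Prop :=
  exists M : R, forall x, `|T x| <= M * `|x|.

Definition bounded_bilinear (B : {bilinear E -> F -> G}) : Prop :=
  exists M : R, forall x y, `|B x y| <= M * `|x| * `|y|.

End boundedness.

Definition topological_dual (R : realType) (G : normedModType R) : Type :=
  {phi : {linear G -> R^o} | bounded_linear phi}.

Definition dual_eval (R : realType) (G : normedModType R) (x : G) :
  {ptws topological_dual G -> R} := fun phi => sval phi x.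

(* [G] with its weak topology, the initial topology for the functionals in
   [topological_dual G]. *)
Definition weak_space (R : realType) (G : normedModType R) : Type :=
  initial_topology (@dual_eval R G).

HB.instance Definition _ (R : realType) (G : normedModType R) :=
  Topological.on (weak_space G).

Variant covariation_mode := Strong | Weak.

Definition mode_cvg (R : realType) (G : normedModType R)
    (m : covariation_mode) (u : nat -> G) (l : G) : Prop :=
  match m with
  | Strong => u @ \oo --> l
  | Weak => (u : nat -> weak_space G) @ \oo --> (l : weak_space G)
  end.

Section covariation.
Variables (R : realType) (E F G : normedModType R) (m : covariation_mode).

Definition is_covariation (B : E -> F -> G) (pi : nat -> time_partition R)
    (X : R -> E) (Y : R -> F) (Q : R -> G) : Prop :=
  [/\ cadlag Q, finite_variation Q,
      forall t, 0 <= t ->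
        mode_cvg m (fun n => covariation_sum B (pi n) X Y t) (Q t)
    & forall t, 0 <= t -> jump Q t = B (jump X t) (jump Y t)].

Definition has_covariation (B : E -> F -> G) (pi : nat -> time_partition R)
    (X : R -> E) (Y : R -> F) : Prop :=
  exists Q, is_covariation B pi X Y Q.

End covariation.

(* Main.v *)
(** A bounded bilinear map [B] factors through the projective tensor product as
  [B = T_B \o ptens] with [T_B] linear and bounded.  Each covariation sum has
  finitely many nonzero terms, so [T_B] maps the tensor covariation sums to the
  [B]-covariation sums; being norm and weakly continuous, it also carries the
  limit, its variation and its jumps from [ptensor E F] to [G].  The converse is
  the case [B = ptens].  That [T_B \o [X, Y]] is the only [B]-covariation is
  uniqueness of limits, which in the weak topology requires the Hahn-Banach
  theorem: the dual must separate points. *)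

Require Import Defs.
From HB Require Import structures.
From mathcomp Require Import all_boot all_order all_algebra.
From mathcomp Require Import all_classical all_reals all_analysis.
From mathcomp Require Import freeg.
Set Implicit Arguments.
Unset Strict Implicit.
Unset Printing Implicit Defensive.
Import Order.TTheory GRing.Theory Num.Theory numFieldNormedType.Exports.
Local Open Scope classical_set_scope.
Local Open Scope ring_scope.

(** * Hahn-Banach by minimal sublinear functionals *)

Section sublinear.
Variables (R : realType) (V : lmodType R).

(** Homogeneity is asked only as an inequality, which is easier to check for infima; equality
    follows by scaling back with [a^-1]. *)
Definition sublinear (q : V -> R) : Prop :=
  (forall x y, q (x + y) <= q x + q y) /\
  (forall a x, 0 <= a -> q (a *: x) <= a * q x).

Lemma sublinear_ge0 q : sublinear q -> 0 <= q 0.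
Proof. by move=> [qD _]; have := qD 0 0; rewrite addr0 lerDl. Qed.

Lemma sublinearZ q a x : sublinear q -> 0 <= a -> q (a *: x) = a * q x.
Proof.
move=> qS; have [_ qZ] := qS; rewrite le_eqVlt => /predU1P[<-|a0].
  apply/eqP; rewrite eq_le qZ//= scale0r mul0r; exact: sublinear_ge0.
have a0' := ltW a0; apply/eqP; rewrite eq_le qZ//= -ler_pdivlMl//.
by rewrite -{1}[x]scale1r -(mulVf (lt0r_neq0 a0)) -scalerA qZ// invr_ge0.
Qed.

Lemma sublinear_geN q x : sublinear q -> - q (- x) <= q x.
Proof.
move=> qS; rewrite -subr_ge0 opprK (le_trans (sublinear_ge0 qS))//.
by rewrite -(subrr x); exact: qS.1.
Qed.

(* The largest sublinear functional below [q] whose value at [- y] is at most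
   [- q y]: a minimal [q] equals it for every [y], hence is odd, hence linear. *)
Definition sublinear_descent (q : V -> R) (y x : V) : R :=
  inf [set q (x + t *: y) - t * q y | t in [set t | 0 <= t]].

Section descent.
Variables (q : V -> R) (y : V) (qS : sublinear q).

Lemma sublinear_descent_le x t :
  0 <= t -> sublinear_descent q y x <= q (x + t *: y) - t * q y.
Proof.
move=> t0; apply: ge_inf; last by exists t.
(* The family is bounded below because [s * q y = q (s *: y) <= q (x + s *: y) + q (- x)]. *)
exists (- q (- x)) => _ [s /= s0 <-].
rewrite lerBrDl lerBlDr -sublinearZ// -{1}[s *: y](addKr x) [leRHS]addrC.
exact: qS.1.
Qed.

Lemma sublinear_descent_ge x c :
  (forall t, 0 <= t -> c <= q (x + t *: y) - t * q y) ->
  c <= sublinear_descent q y x.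
Proof.
move=> h; apply: lb_le_inf; last by move=> _ [t /= t0 <-]; exact: h.
by exists (q (x + 0 *: y) - 0 * q y); exists 0 => /=.
Qed.

Lemma sublinear_descent_dom x : sublinear_descent q y x <= q x.
Proof.
by have := @sublinear_descent_le x 0 (lexx _); rewrite scale0r addr0 mul0r subr0.
Qed.

Lemma sublinear_descentN : sublinear_descent q y (- y) <= - q y.
Proof.
apply: le_trans (@sublinear_descent_le (- y) 1 ler01) _.
rewrite scale1r addNr mul1r gerDr -(scale0r 0); have := qS.2 0 0 (lexx 0).
by rewrite mul0r.
Qed.

Lemma sublinear_descent_sublinear : sublinear (sublinear_descent q y).
Proof.
split=> [x1 x2|a x].
  rewrite -lerBlDl; apply: sublinear_descent_ge => t t0.
  rewrite lerBlDl -lerBlDr; apply: sublinear_descent_ge => s s0.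
  rewrite lerBlDr (le_trans (sublinear_descent_le _ (addr_ge0 s0 t0)))//.
  by rewrite mulrDl opprD [leRHS]addrACA lerD2r scalerDl addrACA; exact: qS.1.
rewrite le_eqVlt => /predU1P[<-|a0].
  rewrite scale0r mul0r (le_trans (sublinear_descent_dom _))//.
  by have := qS.2 0 0 (lexx 0); rewrite scale0r mul0r.
have a0' := ltW a0; rewrite -ler_pdivrMl//; apply: sublinear_descent_ge => t t0.
rewrite ler_pdivrMl// (le_trans (sublinear_descent_le _ (mulr_ge0 a0' t0)))//.
by rewrite -scalerA -scalerDr sublinearZ// mulrBr mulrA.
Qed.

End descent.

Definition minimal_sublinear (q : V -> R) : Prop :=
  sublinear q /\
  forall q', sublinear q' -> (forall x, q' x <= q x) -> q' =1 q.

Lemma minimal_sublinear_linear q : minimal_sublinear q -> linear (q : V -> R^o).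
Proof.
move=> [qS qmin].
have qN x : q (- x) = - q x.
  apply/eqP; rewrite eq_le; apply/andP; split.
    rewrite -(qmin _ (sublinear_descent_sublinear x qS)); last first.
      by move=> ?; exact: sublinear_descent_dom.
    exact: sublinear_descentN.
  by have := sublinear_geN (- x) qS; rewrite opprK.
have qZ a x : q (a *: x) = a * q x.
  have [a0|/ltW a0] := leP 0 a; first exact: sublinearZ.
  have Na0 : 0 <= - a by rewrite oppr_ge0.
  by rewrite -[a]opprK scaleNr qN (sublinearZ _ qS Na0) [RHS]mulNr.
move=> a x y; rewrite [RHS]/(_ + _) /= -[a *: q x]/(a * q x) -qZ.
(* Oddness turns subadditivity around: [q (a *: x) <= q (a *: x + y) + q (- y)]. *)
apply/eqP; rewrite eq_le qS.1/= -lerBrDr -qN.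
by apply: le_trans (qS.1 _ _); rewrite addrK.
Qed.

(* Zorn: a chain is bounded below pointwise, because
   [- p (- x) <= - q (- x) <= q x] for every sublinear [q <= p]. *)
Lemma minimal_sublinear_exists p : sublinear p ->
  exists2 q, minimal_sublinear q & forall x, q x <= p x.
Proof.
move=> pS.
pose T := {q : V -> R | sublinear q /\ forall x, q x <= p x}.
(* The order is reversed, so that Zorn's maximal element is a minimal functional. *)
pose ge (q1 q2 : T) := `[< forall x, sval q2 x <= sval q1 x >].
have [] := @Zorn T ge.
- by move=> q; apply/asboolP.
- move=> q1 q2 q3 /asboolP q12 /asboolP q23; apply/asboolP => x.
  exact: le_trans (q23 x) (q12 x).
- move=> q1 q2 /asboolP q12 /asboolP q21.
  suff : sval q1 = sval q2.
    case: q1 q2 {q12 q21} => [q1 h1] [q2 h2] /= e.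
    by subst q2; rewrite (Prop_irrelevance h1 h2).
  by apply/funext => x; apply/eqP; rewrite eq_le q12 q21.
- move=> A Atot; have [[q0 Aq0]|A0] := pselect (A !=set0); last first.
    exists (exist _ p (conj pS (fun x => lexx (p x)))) => q Aq.
    by case: A0; exists q.
  pose m (x : V) := inf [set sval q x | q in A].
  have m_le q x : A q -> m x <= sval q x.
    move=> Aq; apply: ge_inf; last by exists q.
    exists (- p (- x)) => _ [r Ar <-]; have [rS rp] := svalP r.
    by apply: le_trans (sublinear_geN x rS); rewrite lerN2.
  have m_ge c x : (forall q, A q -> c <= sval q x) -> c <= m x.
    move=> h; apply: lb_le_inf; last by move=> _ [q Aq <-]; exact: h.
    by exists (sval q0 x); exists q0.
  have mS : sublinear m.
    split=> [x y|a x].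
      rewrite -lerBlDl; apply: (m_ge) => q Aq; rewrite lerBlDl -lerBlDr.
      apply: (m_ge) => r Ar; rewrite lerBlDr.
      (* The bounds at [x] and [y] come from two members of the chain; the smaller one serves at
         both points. *)
      have [/asboolP h|/asboolP h] := Atot _ _ Aq Ar.
        apply: le_trans (m_le _ _ Ar) _.
        by apply: le_trans ((svalP r).1.1 _ _) _; rewrite lerD2l.
      apply: le_trans (m_le _ _ Aq) _.
      by apply: le_trans ((svalP q).1.1 _ _) _; rewrite lerD2r.
    rewrite le_eqVlt => /predU1P[<-|a0].
      rewrite mul0r; apply: le_trans (m_le _ _ Aq0) _.
      by have := (svalP q0).1.2 0 x (lexx 0); rewrite mul0r.
    rewrite -ler_pdivrMl//; apply: (m_ge) => q Aq.
    rewrite ler_pdivrMl//; apply: le_trans (m_le _ _ Aq) _.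
    exact: (svalP q).1.2 (ltW a0).
  have mp x : m x <= p x by apply: le_trans (m_le _ _ Aq0) ((svalP q0).2 x).
  by exists (exist _ m (conj mS mp)) => q Aq; apply/asboolP => x; exact: m_le.
- move=> [q [qS qp]] qmax; exists q => //; split=> // q' q'S q'q x.
  have q'p z : q' z <= p z by apply: le_trans (q'q z) (qp z).
  have := qmax (exist _ q' (conj q'S q'p)).
  by move=> /(_ (introT (asboolP _) q'q)) [->].
Qed.

End sublinear.

Lemma linear_exists (R : realType) (V W : lmodType R) (f : V -> W) :
  linear f -> exists g : {linear V -> W}, g =1 f.
Proof.
move=> fL; pose gM := GRing.isLinear.Build R V W *:%R f fL.
by exists (HB.pack_for {linear V -> W} f gM).
Qed.

(** A minimal functional below the descent of the norm at [x] is linear, at most the norm, and at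
    most [- |x|] at [- x]. If it vanishes at [x], then [|x| <= 0]. *)
Lemma dual_separates (R : realType) (G : normedModType R) (x : G) :
  (forall phi : topological_dual G, sval phi x = 0) -> x = 0.
Proof.
move=> x0.
have nS : sublinear (fun z : G => `|z|).
  by split=> [*|a z a0]; rewrite ?ler_normD// normrZ ger0_norm.
have [q qmin qp] := minimal_sublinear_exists
  (sublinear_descent_sublinear x nS).
have [phi phiE] := linear_exists (minimal_sublinear_linear qmin).
have phi_le z : phi z <= `|z|.
  by rewrite phiE (le_trans (qp _))// sublinear_descent_dom.
have phiB : bounded_linear phi.
  exists 1 => z; rewrite mul1r ler_norml phi_le andbT lerNl -linearN.
  by rewrite (le_trans (phi_le _))// normrN.
have := x0 (exist _ phi phiB) => /= phix.
have : phi (- x) <= - `|x|.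
  by rewrite phiE (le_trans (qp _))// sublinear_descentN.
by rewrite linearN phix oppr0 oppr_ge0 normr_le0 => /eqP.
Qed.

(** * Universal property of the projective tensor product *)

Lemma freeg_universal (R : nzRingType) (K : choiceType) (M : lmodType R)
    (f : K -> M) :
  exists g : {linear {freeg K / R} -> M}, forall k, g <<k>> = f k.
Proof.
have gD : additive (fglift f) by exact: lift_is_additive.
pose gA := HB.pack_for {additive {freeg K / R} -> M} (fglift f)
  (GRing.isAdditive.Build _ _ _ gD).
have gZ : scalable (fglift f).
  move=> a D; rewrite -[in RHS](freeg_sumE D).
  (* Scaling in the free module unfolds to this sum, to which additivity applies. *)
  rewrite -[LHS]/(gA (\sum_(k <- dom D) <<a * coeff k D *g k>>)).
  rewrite -[X in _ = _ *: X]/(gA _) !raddf_sum.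
  by apply: eq_bigr => k _; rewrite /= !liftU scalerA.
pose gL := HB.pack_for {linear {freeg K / R} -> M} (fglift f)
  (GRing.isAdditive.Build _ _ _ gD) (GRing.isScalable.Build _ _ _ _ _ gZ).
by exists gL => k; rewrite /= liftU scale1r.
Qed.

Lemma lquot_universal (R : nzRingType) (V W : lmodType R) (S : submodule V)
    (f : {linear V -> W}) : (forall v, v \in S -> f v = 0) ->
  exists g : {linear lquot S -> W}, forall v, g (lpi S v) = f v.
Proof.
move=> f0; pose g (x : lquot S) : W := f (repr x).
have gE v : g (lpi S v) = f v.
  apply/eqP; rewrite -subr_eq0 -linearB f0//.
  by apply/lpi_eq; rewrite /lpi reprK.
have gL : linear g.
  move=> a x y; have [u ->] := lpi_surj x; have [v ->] := lpi_surj y.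
  by rewrite -linearP !gE linearP.
pose gM := GRing.isLinear.Build R (lquot S) W *:%R g gL.
by exists (HB.pack_for {linear lquot S -> W} g gM).
Qed.

Lemma atensor_universal (R : realType) (E F G : lmodType R)
    (B : {bilinear E -> F -> G}) :
  exists T : {linear atensor E F -> G}, forall x y, T (atens x y) = B x y.
Proof.
have [f fE] := freeg_universal (fun z : E * F => B z.1 z.2).
have f_rel u : bilinear_relation u -> f u = 0.
  case=> *; apply/eqP; rewrite linearB subr_eq0 ?linearD ?linearZ/= !fE/=.
  - by rewrite linearDl.
  - by rewrite linearDr.
  - by rewrite linearZl_LR.
  - by rewrite linearZr_LR.
have [|T TE] := @lquot_universal R _ _ (lspan (@bilinear_relation R E F)) f.
  move=> v /asboolP; elim=> [|a u w u_rel _ w0]; first exact: linear0.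
  by rewrite linearP f_rel// w0 scaler0 addr0.
by exists T => x y; rewrite -[RHS](fE (x, y)) -TE.
Qed.

(** The triangle inequality bounds [T u] by every representation of [u] as a sum of elementary
    tensors, hence by their infimum. The absolute value is there because [M] may be negative. *)
Lemma atensor_universal_bounded (R : realType) (E F G : normedModType R)
    (B : {bilinear E -> F -> G}) (M : R) (T : {linear atensor E F -> G}) :
  (forall x y, `|B x y| <= M * `|x| * `|y|) ->
  (forall x y, T (atens x y) = B x y) ->
  forall u, `|T u| <= `|M| * proj_norm u.
Proof.
move=> BM TB u.
have le s : u = tensor_sum s -> `|T u| <= `|M| * rep_norm s.
  move=> ->; rewrite linear_sum (le_trans (ler_norm_sum _ _ _))//.
  rewrite mulr_sumr ler_sum// => z _; rewrite TB (le_trans (BM _ _))//.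
  by rewrite -mulrA ler_wpM2r ?ler_norm// mulr_ge0.
(* Passing to the infimum divides by the absolute value of [M], so zero is treated apart. *)
have [M0|M0] := eqVneq M 0.
  have [s us] := tensor_sum_surj u; have := le s us.
  by rewrite M0 normr0 !mul0r.
have M0' : 0 < `|M| by rewrite normr_gt0.
rewrite -ler_pdivrMl//; apply: proj_norm_ge => s us.
by rewrite ler_pdivrMl// le.
Qed.

(** The bound makes [f] send Cauchy sequences to Cauchy sequences, which converge in the complete
    space [G]. In the limit the bound shows that null sequences go to 0, so the limit map descends
    to the quotient. *)
Lemma completion_universal (R : realType) (V : lmodType R) (p : seminorm V)
    (G : completeNormedModType R) (f : {linear V -> G}) (M : R) :
  0 <= M -> (forall v, `|f v| <= M * p v) ->
  exists g : {linear completion p -> G},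
    (forall z, `|g z| <= M * `|z|) /\ forall v, g (completion_in p v) = f v.
Proof.
move=> M0 fM.
have f_cvg (u : cauchyT p) : cvg (f (cauchyT_val u n) @[n --> \oo]).
  apply/cauchy_cvgP/cauchy_exP => e e0.
  (* [M] may be 0, so the tolerance is divided by [M + 1]. *)
  have M1 : 0 < M + 1 by rewrite ltr_wpDl.
  have [N uN] := cauchyTE u (divr_gt0 e0 M1).
  exists (f (cauchyT_val u N)); exists N => // n /= Nn.
  rewrite -ball_normE /= -linearB (le_lt_trans (fM _))//.
  apply: (@le_lt_trans _ _ ((M + 1) * p (cauchyT_val u N - cauchyT_val u n))).
    by rewrite ler_wpM2r ?seminorm_ge0// lerDl.
  by rewrite mulrC -ltr_pdivlMr// uN.
pose h (u : cauchyT p) : G := lim (f (cauchyT_val u n) @[n --> \oo]).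
have hL : linear h.
  move=> a u v; apply/cvg_lim => //.
  under eq_fun do rewrite /= linearP.
  by apply: cvgD; [apply: cvgZr|]; exact: f_cvg.
pose hM := GRing.isLinear.Build R (cauchyT p) G *:%R h hL.
pose h' := HB.pack_for {linear cauchyT p -> G} h hM.
have h_le (u : cauchyT p) : `|h u| <= M * completion_norm (lpi (null_submodule p) u).
  have hu : `|f (cauchyT_val u n)| @[n --> \oo] --> `|h u|
    by apply: cvg_norm; exact: f_cvg.
  apply: ler_cvg_to hu (cvgMl_tmp (@completion_norm_cvg _ _ p u)) _.
  by apply: nearW => n /=; exact: fM.
have [|g gE] := @lquot_universal R _ _ (null_submodule p) h'.
  move=> u /asboolP u0; apply/normr0_eq0/eqP; rewrite eq_le normr_ge0 andbT.
  rewrite (le_trans (h_le u))// completion_normE.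
  by rewrite (cvg_lim _ u0)// mulr0.
exists g; split=> [z|v].
  by have [u ->] := lpi_surj z; rewrite gE; exact: h_le.
by rewrite /completion_in gE /= /h /= lim_cst.
Qed.

Lemma bounded_linear_cts (R : realType) (G H : normedModType R)
    (T : {linear G -> H}) : bounded_linear T -> continuous T.
Proof.
move=> [M TM]; apply/bounded_linear_continuous/bounded_funP => r.
exists (`|M| * r) => x xr; rewrite (le_trans (TM x))//.
by rewrite (le_trans (ler_wpM2r (normr_ge0 x) (ler_norm M)))// ler_wpM2l.
Qed.

Lemma ptensor_universal (R : realType) (E F : normedModType R)
    (G : completeNormedModType R) (B : {bilinear E -> F -> G}) :
  bounded_bilinear B ->
  exists T : {linear ptensor E F -> G},
    bounded_linear T /\ forall x y, T (ptens x y) = B x y.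
Proof.
move=> [M BM]; have [T0 T0E] := atensor_universal B.
have [T [TM TE]] := @completion_universal _ _ (proj_seminorm E F) _ _ _
  (normr_ge0 M) (atensor_universal_bounded BM T0E).
by exists T; split=> [|x y]; [exists `|M| | rewrite TE T0E].
Qed.

(** Agreement on elementary tensors spreads to the algebraic tensor product by linearity, then to
    its completion by continuity, each point being a limit of algebraic tensors. *)
Lemma ptensor_linear_ext (R : realType) (E F G : normedModType R)
    (T T' : {linear ptensor E F -> G}) :
  bounded_linear T -> bounded_linear T' ->
  (forall x y, T (ptens x y) = T' (ptens x y)) -> T =1 T'.
Proof.
move=> /bounded_linear_cts Tc /bounded_linear_cts T'c TT' z.
have [u ->] := lpi_surj z; have uz := @completion_in_cvg _ _ _ u.
have TE v : T (completion_in _ v) = T' (completion_in _ v).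
  have [s ->] := tensor_sum_surj v.
  by rewrite /tensor_sum !linear_sum; apply: eq_bigr => -[x y] _; exact: TT'.
have Tz := cvg_comp _ _ uz (Tc (lpi _ u)).
have T'z := cvg_comp _ _ uz (T'c (lpi _ u)).
apply: (cvg_unique _ Tz) => //.
suff -> : T \o (fun n => completion_in (proj_seminorm E F) (cauchyT_val u n)) =
  T' \o (fun n => completion_in (proj_seminorm E F) (cauchyT_val u n)) by exact: T'z.
by apply/funext => n; exact: TE.
Qed.

(** * Strong and weak convergence *)

(** Serves twice: for the coordinates of the pointwise topology, and for the weak topology as the
    initial topology of [dual_eval]. *)
Lemma cvg_initialP (S : choiceType) (T : topologicalType) (f : S -> T)
    (F : set_system S) (s : S) : Filter F ->
  (F --> (s : initial_topology f)) <-> (f @ F --> f s).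
Proof.
move=> FF; split=> [Fs|Ffs].
  apply: cvg_comp Fs _; exact: initial_continuous.
move=> A /= [_ [[B oB <-] Bfs BA]]; apply: filterS BA _.
by apply: Ffs; exact: open_nbhs_nbhs.
Qed.

Lemma cvg_ptwsP (I : Type) (T : topologicalType) (F : set_system (I -> T))
    (f : I -> T) : Filter F ->
  (F --> (f : {ptws I -> T})) <-> forall i, g i @[g --> F] --> f i.
Proof.
move=> FF; rewrite cvg_sup; split=> h i; have := h i.
  by move/(@cvg_initialP _ _ (fun g : I -> T => g i) F f FF).
by move=> ?; apply/(@cvg_initialP _ _ (fun g : I -> T => g i) F f FF).
Qed.

Section mode_cvg.
Variables (R : realType).
Implicit Types G H : normedModType R.

Lemma mode_cvg_weakP G (u : nat -> G) (l : G) : mode_cvg Weak u l <->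
  forall phi : topological_dual G, sval phi (u n) @[n --> \oo] --> sval phi l.
Proof.
rewrite /mode_cvg; split.
  move/(@cvg_initialP _ _ (@dual_eval R G) _ _ _).
  by move/(@cvg_ptwsP _ _ _ _ _) => h phi; exact: h.
move=> h; apply/(@cvg_initialP _ _ (@dual_eval R G) _ _ _).
by apply/(@cvg_ptwsP _ _ _ _ _) => phi; exact: h.
Qed.

Lemma mode_cvg_linear G H m (T : {linear G -> H}) u l :
  bounded_linear T -> mode_cvg m u l -> mode_cvg m (T \o u) (T l).
Proof.
move=> TB; case: m => [ul|/mode_cvg_weakP ul].
  by apply: cvg_comp ul _; exact: bounded_linear_cts.
apply/mode_cvg_weakP => phi.
(* Weak continuity of [T]: a functional on [H] pulls back along [T] to a bounded functional on
   [G]. *)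
have [psi psiE] : exists psi : topological_dual G,
    forall x, sval psi x = sval phi (T x).
  have [M TM] := TB; have [N phiN] := svalP phi.
  suff psiB : bounded_linear (sval phi \o T : {linear G -> R^o}).
    by exists (exist _ _ psiB).
  exists (`|N| * M) => x /=; rewrite (le_trans (phiN _))// -mulrA.
  by rewrite (le_trans (ler_wpM2r (normr_ge0 _) (ler_norm N)))// ler_wpM2l.
by have := ul psi; under eq_fun do rewrite psiE; rewrite psiE.
Qed.

Lemma mode_cvg_unique G m (u : nat -> G) l l' :
  mode_cvg m u l -> mode_cvg m u l' -> l = l'.
Proof.
case: m => [ul ul'|/mode_cvg_weakP ul /mode_cvg_weakP ul'].
  exact: (cvg_unique _ ul ul').
apply/eqP; rewrite -subr_eq0; apply/eqP/dual_separates => phi.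
rewrite linearB; apply/eqP; rewrite subr_eq0; apply/eqP.
exact: (cvg_unique _ (ul phi) (ul' phi)).
Qed.

End mode_cvg.

(** * Covariation sums as finite sums *)

Section paths.
Context {R : realType} {E F : normedModType R}.

(** Once [pi i] has passed [t], both endpoints are clipped to [t]. *)
Lemma increment_eq0 (V : zmodType) (X : R -> V) (pi : time_partition R) t :
  \forall i \near \oo, increment X (pi i) (pi i.+1) t = 0.
Proof.
have /cvgryPge/(_ t) := pt_oo pi; apply: filterS => i ti.
have ti' : t <= pi i.+1 by rewrite (le_trans ti)// ltW// pt_lt.
by rewrite /increment !min_r// subrr.
Qed.

(** The cutoff [N] depends on [X] and not on [B], so a single [N] serves two bilinear maps at
    once. *)
Lemma covariation_sumE (G : lmodType R) (B : {bilinear E -> F -> G})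
    (pi : time_partition R) (X : R -> E) (Y : R -> F) t N :
  (forall i, (N <= i)%N -> increment X (pi i) (pi i.+1) t = 0) ->
  covariation_sum B pi X Y t =
  \sum_(i < N) B (increment X (pi i) (pi i.+1) t)
                 (increment Y (pi i) (pi i.+1) t).
Proof.
move=> X0; rewrite /covariation_sum (fsbig_ord _ _ (fun i =>
  B (increment X (pi i) (pi i.+1) t) (increment Y (pi i) (pi i.+1) t))).
symmetry; apply: fsbig_widen => // i [_ /=] /negP.
by rewrite -leqNgt => /X0 ->; rewrite linear0l.
Qed.

Lemma covariation_sum_linear (G H : lmodType R) (B : {bilinear E -> F -> G})
    (B' : {bilinear E -> F -> H}) (T : {linear G -> H})
    (pi : time_partition R) X Y t :
  (forall x y, T (B x y) = B' x y) ->
  T (covariation_sum B pi X Y t) = covariation_sum B' pi X Y t.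
Proof.
move=> TB; have [N _ X0] := increment_eq0 X pi t.
rewrite !(covariation_sumE _ _ X0) linear_sum.
by apply: eq_bigr => i _; exact: TB.
Qed.

End paths.

(** * Transport of covariations along a bounded linear map *)

Section linear_image.
Context {R : realType} {G H : normedModType R} (T : {linear G -> H}).
Hypothesis TB : bounded_linear T.
Implicit Types Q : R -> G.

Lemma cadlag_linear Q : cadlag Q -> cadlag (T \o Q).
Proof.
move=> Qc t t0; have [Qr Ql] := Qc t t0; have Tc := bounded_linear_cts TB.
split=> [|/Ql[l Ql']]; first exact: (cvg_comp _ _ Qr (Tc _)).
by exists (T l); exact: (cvg_comp _ _ Ql' (Tc _)).
Qed.

Lemma finite_variation_linear Q :
  finite_variation Q -> finite_variation (T \o Q).
Proof.
move=> QV a b a0 ab; have := QV a b a0 ab.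
have le s : itv_partition a b s ->
    ((path_variation a b Q s)%:E <= path_total_variation a b Q)%E.
  by move=> abs; apply: ereal_sup_ubound; exists s.
have [M TM] := TB.
have TV s : path_variation a b (T \o Q) s <= `|M| * path_variation a b Q s.
  rewrite /path_variation mulr_sumr; apply: ler_sum => i _ /=.
  by rewrite -linearB (le_trans (TM _))// ler_wpM2r// ler_norm.
(* The supremum is real, or it is [-oo] and then no partition exists, since each would give a real
   lower bound. *)
case: (path_total_variation a b Q) le => [K||] le; rewrite ?ltxx// => _.
  apply: (@le_lt_trans _ _ (`|M| * K)%:E); last exact: ltry.
  apply: ub_ereal_sup => _ [s abs <-]; rewrite lee_fin (le_trans (TV s))//.
  by rewrite ler_wpM2l// -lee_fin le.
apply: (@le_lt_trans _ _ 0%E); last exact: ltry.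
by apply: ub_ereal_sup => _ [s /le + <-].
Qed.

(** The càdlàg hypothesis makes [lim] a genuine left limit, not a default value, so continuity of
    [T] applies to it. *)
Lemma jump_linear Q t : cadlag Q -> 0 <= t -> jump (T \o Q) t = T (jump Q t).
Proof.
move=> Qc t0; rewrite /jump; case: ifPn => [t0'|_]; last by rewrite linear0.
have [l Ql] := (Qc t t0).2 t0'.
have Tc := bounded_linear_cts TB; have TQl := cvg_comp _ _ Ql (Tc l).
by rewrite (cvg_lim _ Ql)// (cvg_lim _ TQl)// linearB.
Qed.

Lemma is_covariation_linear {E F : normedModType R} m
    (B : {bilinear E -> F -> G}) (B' : {bilinear E -> F -> H})
    (pi : nat -> time_partition R) X Y Q :
  (forall x y, T (B x y) = B' x y) ->
  is_covariation m B pi X Y Q -> is_covariation m B' pi X Y (T \o Q).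
Proof.
move=> TB' [Qc QV Qlim Qjump]; split.
- exact: cadlag_linear.
- exact: finite_variation_linear.
- move=> t t0; have := mode_cvg_linear TB (Qlim t t0).
  congr (mode_cvg _ _ _); apply/funext => n /=; exact: covariation_sum_linear.
- by move=> t t0; rewrite jump_linear// Qjump.
Qed.

End linear_image.

(** * Uniqueness and the equivalence *)

Lemma is_covariation_unique (R : realType) (E F G : normedModType R) m
    (B : E -> F -> G) (pi : nat -> time_partition R) X Y Q Q' :
  is_covariation m B pi X Y Q -> is_covariation m B pi X Y Q' ->
  forall t, 0 <= t -> Q t = Q' t.
Proof.
move=> [_ _ Qlim _] [_ _ Q'lim _] t t0.
exact: mode_cvg_unique (Qlim t t0) (Q'lim t t0).
Qed.

Lemma ptens_bounded (R : realType) (E F : normedModType R) :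
  bounded_bilinear (@ptens R E F).
Proof. by exists 1 => x y; rewrite mul1r ptens_norm. Qed.

Theorem proposition3p2 (R : realType) (E F : completeNormedModType R)
    (pi : nat -> time_partition R) (X : R -> E) (Y : R -> F)
    (XY_cadlag : cadlag (fun t => (X t, Y t) : E * F)) (m : covariation_mode) :
  (has_covariation m (@ptens R E F) pi X Y <->
   forall (G : completeNormedModType R) (B : {bilinear E -> F -> G}),
     bounded_bilinear B -> has_covariation m B pi X Y) /\
  (has_covariation m (@ptens R E F) pi X Y ->
   forall (G : completeNormedModType R) (B : {bilinear E -> F -> G}),
     bounded_bilinear B ->
     exists T : {linear ptensor E F -> G},
       [/\ bounded_linear T,
           (forall x y, T (ptens x y) = B x y),
           (forall T' : {linear ptensor E F -> G}, bounded_linear T' ->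
              (forall x y, T' (ptens x y) = B x y) -> T' =1 T)
         & forall (Q : R -> ptensor E F) (QB : R -> G),
             is_covariation m (@ptens R E F) pi X Y Q ->
             is_covariation m B pi X Y QB ->
             forall t, 0 <= t -> T (Q t) = QB t]).
Proof.
have image (G : completeNormedModType R) (B : {bilinear E -> F -> G})
    (T : {linear ptensor E F -> G}) : bounded_linear T ->
    (forall x y, T (ptens x y) = B x y) -> forall Q,
    is_covariation m (@ptens R E F) pi X Y Q ->
    is_covariation m B pi X Y (T \o Q).
  by move=> TB TE Q; apply: is_covariation_linear.
split; first split=> [[Q QP] G B BB|]; last 2 first.
(* The tensor product is itself an admissible target, being complete. *)
- by move=> /(_ (ptensor E F) (@ptens R E F)); apply; exact: ptens_bounded.
- move=> _ G B BB; have [T [TB TE]] := ptensor_universal BB.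
  exists T; split=> // [T' T'B T'E|Q QB QP QBP t t0].
    by apply: ptensor_linear_ext => // x y; rewrite TE T'E.
  (* Both [T \o Q] and [QB] are [B]-covariations of the same paths. *)
  exact: (is_covariation_unique (image _ _ _ TB TE _ QP) QBP).
have [T [TB TE]] := ptensor_universal BB.
by exists (T \o Q); exact: image.
Qed.
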